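(* Let $A$ be a finite dimensional local algebra over a field $K$, let $M$ be any finitely generated right $A$-module, and let $\Lambda=A[M]$ be the one-point extension. Then $k\text{-}\operatorname{ddell}\Lambda<\infty$ for every integer $k\ge1$.
   Context: The one-point extension is the matrix algebra $A[M]=\begin{pmatrix}K&M\\0&A\end{pmatrix}$, with $M$ viewed as a $K$-$A$-bimodule; as right modules, its indecomposable projectives are $A$ (annihilated by the new idempotent) and one further projective whose radical is $M$ and whose top is the new simple module. For a finite dimensional algebra $\Lambda$, $\mathrm{mod}\,\Lambda$ is the category of finitely generated right $\Lambda$-modules. $\mathbb N$ is the set of nonnegative integers; the infimum of the empty set is $+\infty$. $\Omega X$ is the kernel of a projective cover of $X$, $\Omega^0X=X$, $\Omega^{n+1}X=\Omega(\Omega^nX)$. ''$U$ is a direct summand of $V$ up to projective summands'' means that $U$ is isomorphic to a direct summand of $V\oplus P$ for some projective $P$. For an integer $j\ge1$, $j\text{-}\operatorname{dell}X$ is the infimum of all $n\in\mathbb N$ such that $\Omega^nX$ is a direct summand of $\Omega^{n+j}N$ up to projective summands for some $N\in\mathrm{mod}\,\Lambda$. $k\text{-}\operatorname{ddell}X$ is the infimum of all $m\in\mathbb N$ for which there exist $0\le n\le m$ and an exact sequence $0\to C_n\to\cdots\to C_1\to C_0\to X\to0$ in $\mathrm{mod}\,\Lambda$ with $(i+k)\text{-}\operatorname{dell}C_i\le m-i$ for $i=0,\dots,n$. $k\text{-}\operatorname{ddell}\Lambda=\sup\{k\text{-}\operatorname{ddell}S\mid S\text{ a simple right }\Lambda\text{-module}\}$.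 *)

(* Defs.v *)
From HB Require Import structures.
From mathcomp Require Import all_boot all_order all_algebra all_field.
From mathcomp Require Import boolp.

Set Implicit Arguments.
Unset Strict Implicit.
Unset Printing Implicit Defensive.

Import GRing.Theory.
Local Open Scope ring_scope.

Inductive enat : Type := Fin of nat | Infty.

Definition enat_le (x y : enat) : Prop :=
  match x, y with
  | _, Infty => True
  | Infty, Fin _ => False
  | Fin m, Fin n => (m <= n)%N
  end.

Definition enat_inf (P : nat -> Prop) : enat :=
  match pselect (exists n, (fun n => `[< P n >]) n) with
  | left exP => Fin (ex_minn exP)
  | right _ => Infty
  end.

(* The least upper bound is the least finite upper bound, or [Infty] when there
   is no finite upper bound. *)
Definition enat_sup (P : enat -> Prop) : enat :=
  enat_inf (fun b => forall x, P x -> enat_le x (Fin b)).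

(* Right modules over [R] are left modules over the converse ring [R^c]:
   the product m.r is [(r : R^c) *: m]. *)
Notation rmodType R := (lmodType R^c).

Section Modules.
Variable R : nzRingType.
Implicit Types U V W : rmodType R.

Definition surjective U V (f : U -> V) : Prop := forall v, exists u, f u = v.

Definition isomorphic U V : Prop := exists f : {linear U -> V}, bijective f.

Definition exact_at U V W (f : U -> V) (g : V -> W) : Prop :=
  forall v, g v = 0 <-> exists u, f u = v.

Definition submodule V (L : V -> Prop) : Prop :=
  L 0 /\ forall (r : R^c) (u v : V), L u -> L v -> L (r *: u + v).

Definition simple V : Prop :=
  (exists v : V, v <> 0) /\
  forall L : V -> Prop, submodule L ->
    (forall v, L v -> v = 0) \/ (forall v, L v).

Definition projective V : Prop :=
  forall (U W : rmodType R) (g : {linear U -> W}) (f : {linear V -> W}),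
    surjective g -> exists h : {linear V -> U}, forall v, g (h v) = f v.

Definition superfluous V (L : V -> Prop) : Prop :=
  forall L' : V -> Prop, submodule L' ->
    (forall v, exists u w, [/\ L u, L' w & v = u + w]) -> forall v, L' v.

Definition projective_cover U V (p : {linear U -> V}) : Prop :=
  [/\ projective U, surjective p & superfluous (fun u => p u = 0)].

Definition summand U V : Prop := exists W, isomorphic (U * W)%type V.

Definition finitely_generated V : Prop :=
  exists (n : nat) (g : 'I_n -> V), forall v,
    exists c : 'I_n -> R^c, v = \sum_i c i *: g i.

End Modules.

(* The category mod R. *)
Record fgmod (R : nzRingType) : Type := FGMod {
  fgmod_sort :> rmodType R;
  fgmodP : finitely_generated fgmod_sort
}.

Section Ddell.
Variable R : nzRingType.
Implicit Types X Y Z N P : fgmod R.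

(* Y is (isomorphic to) the kernel of a projective cover of X. *)
Definition syzygy X Y : Prop :=
  exists P (p : {linear P -> X}) (i : {linear Y -> P}),
    [/\ projective_cover p, injective i & exact_at i p].

(* Y is (isomorphic to) the n-th syzygy of X. *)
Fixpoint nsyzygy (n : nat) X Y : Prop :=
  match n with
  | 0 => isomorphic X Y
  | n'.+1 => exists Z, nsyzygy n' X Z /\ syzygy Z Y
  end.

Definition stable_summand X Y : Prop :=
  exists P, projective P /\ summand X (Y * P)%type.

Definition dell (j : nat) X : enat :=
  enat_inf (fun n => exists Y N Z,
    [/\ nsyzygy n X Y, nsyzygy (n + j) N Z & stable_summand Y Z]).

(* An exact sequence 0 -> C_n -> ... -> C_0 -> X -> 0, encoded as an exact
   sequence unbounded to the left whose terms C_i vanish for i > n. *)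
Definition exact_resolution (n : nat) X (C : nat -> fgmod R)
    (d : forall i, {linear C i.+1 -> C i}) (e : {linear C 0%N -> X}) : Prop :=
  [/\ surjective e, exact_at (d 0%N) e,
      forall i, exact_at (d i.+1) (d i) &
      forall i, (n < i)%N -> forall x : C i, x = 0].

Definition ddell (k : nat) X : enat :=
  enat_inf (fun m => exists n, (n <= m)%N /\
    exists (C : nat -> fgmod R) (d : forall i, {linear C i.+1 -> C i})
           (e : {linear C 0%N -> X}),
      exact_resolution n d e /\
      forall i, (i <= n)%N -> enat_le (dell (i + k) (C i)) (Fin (m - i))).

Definition ddell_ring (k : nat) : enat :=
  enat_sup (fun x => exists S : fgmod R, simple S /\ x = ddell k S).

End Ddell.

Definition maximal_right_ideal (R : nzRingType) (I : R^c^o -> Prop) : Prop :=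
  [/\ submodule I, ~ I 1 &
      forall J : R^c^o -> Prop, submodule J -> ~ J 1 ->
        (forall x, I x -> J x) -> forall x, J x -> I x].

Definition local_ring (R : nzRingType) : Prop :=
  exists I : R^c^o -> Prop, maximal_right_ideal I /\
    forall J : R^c^o -> Prop, maximal_right_ideal J -> forall x, J x <-> I x.

(* The triple (a, m, x) stands for the matrix with rows (a, m) and (0, x). *)
Definition onept_ext (K : fieldType) (A : falgType K) (M : rmodType A) : Type :=
  (K * M * A)%type.

HB.instance Definition _ (K : fieldType) (A : falgType K) (M : rmodType A) :=
  GRing.Zmodule.copy (onept_ext M) (K * M * A)%type.

Section OnePointExtension.
Variables (K : fieldType) (A : falgType K) (M : rmodType A).
Local Notation E := (onept_ext M).

(* K acts on M, on either side, through the structure map K -> A; n.y is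
   written [(y : A^c) *: n], see [rmodType]. *)
Definition onept_mul (u v : E) : E :=
  let: (a, m, x) := u in
  let: (b, n, y) := v in
  (a * b, (a%:A : A^c) *: n + (y : A^c) *: m, x * y).

Definition onept_one : E := (1, 0, 1).

Let act (m : M) (x : A) : M := (x : A^c) *: m.

Let actA m x y : act (act m x) y = act m (x * y).
Proof. exact: scalerA. Qed.

Let act1 m : act m 1 = m.
Proof. exact: scale1r. Qed.

Let actDl m n x : act (m + n) x = act m x + act n x.
Proof. exact: scalerDr. Qed.

Let actDr m x y : act m (x + y) = act m x + act m y.
Proof. exact: scalerDl. Qed.

Let act0 x : act 0 x = 0.
Proof. exact: scaler0. Qed.

Let onept_mulE a m x b n y :
  onept_mul (a, m, x) (b, n, y) = (a * b, act n a%:A + act m y, x * y).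
Proof. by []. Qed.

Fact onept_mulA : associative onept_mul.
Proof.
move=> [[a m] x] [[b n] y] [[c p] z]; rewrite !onept_mulE !actDl !actA !mulrA.
congr (_, _, _); rewrite addrA; congr (act _ _ + act _ _ + _).
  by rewrite mulr_algl scalerA mulrC.
by rewrite mulr_algl mulr_algr.
Qed.

Fact onept_mul1 : left_id onept_one onept_mul.
Proof.
by move=> [[a m] x]; rewrite onept_mulE !mul1r scale1r act1 act0 addr0.
Qed.

Fact onept_mulr1 : right_id onept_one onept_mul.
Proof. by move=> [[a m] x]; rewrite onept_mulE !mulr1 act0 act1 add0r. Qed.

Fact onept_mulDl : left_distributive onept_mul +%R.
Proof.
move=> [[a m] x] [[b n] y] [[c p] z].
change (onept_mul (a + b, m + n, x + y) (c, p, z) =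
  (a * c + b * c, (act p a%:A + act m z) + (act p b%:A + act n z),
   x * z + y * z)).
by rewrite onept_mulE !mulrDl scalerDl actDr actDl addrACA.
Qed.

Fact onept_mulDr : right_distributive onept_mul +%R.
Proof.
move=> [[a m] x] [[b n] y] [[c p] z].
change (onept_mul (a, m, x) (b + c, n + p, y + z) =
  (a * b + a * c, (act n a%:A + act m y) + (act p a%:A + act m z),
   x * y + x * z)).
by rewrite onept_mulE !mulrDr actDl actDr addrACA.
Qed.

Fact onept_one_neq0 : onept_one != 0.
Proof. by apply/eqP => -[/eqP]; rewrite oner_eq0. Qed.

HB.instance Definition _ := GRing.Zmodule_isNzRing.Build E
  onept_mulA onept_mul1 onept_mulr1 onept_mulDl onept_mulDr onept_one_neq0.

Definition onept_scale (c : K) (u : E) : E :=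
  let: (a, m, x) := u in (c * a, (c%:A : A^c) *: m, c *: x).

Let onept_scaleE c a m x :
  onept_scale c (a, m, x) = (c * a, act m c%:A, c *: x).
Proof. by []. Qed.

Fact onept_scaleA c d u :
  onept_scale c (onept_scale d u) = onept_scale (c * d) u.
Proof.
case: u => [[a m] x]; rewrite !onept_scaleE actA mulrA scalerA.
by rewrite mulr_algl scalerA [d * c]mulrC.
Qed.

Fact onept_scale1 : left_id 1 onept_scale.
Proof. by move=> [[a m] x]; rewrite onept_scaleE mul1r !scale1r act1. Qed.

Fact onept_scaleDr : right_distributive onept_scale +%R.
Proof.
move=> c [[a m] x] [[b n] y].
change (onept_scale c (a + b, m + n, x + y) =
  (c * a + c * b, act m c%:A + act n c%:A, c *: x + c *: y)).
by rewrite onept_scaleE mulrDr actDl scalerDr.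
Qed.

Fact onept_scaleDl u : {morph onept_scale^~ u : c d / c + d}.
Proof.
case: u => [[a m] x] c d.
change (onept_scale (c + d) (a, m, x) =
  (c * a + d * a, act m c%:A + act m d%:A, c *: x + d *: x)).
by rewrite onept_scaleE mulrDl !scalerDl actDr.
Qed.

HB.instance Definition _ := GRing.Zmodule_isLmodule.Build K E
  onept_scaleA onept_scale1 onept_scaleDr onept_scaleDl.

Fact onept_scaleAl (c : K) (u v : E) : c *: (u * v) = (c *: u) * v.
Proof.
case: u v => [[a m] x] [[b n] y].
change (onept_scale c (onept_mul (a, m, x) (b, n, y)) =
        onept_mul (onept_scale c (a, m, x)) (b, n, y)).
rewrite onept_mulE !onept_scaleE onept_mulE actDl !actA.
by rewrite !mulr_algl mulr_algr scalerA mulrA [a * c]mulrC scalerAl.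
Qed.

HB.instance Definition _ := GRing.Lmodule_isLalgebra.Build K E onept_scaleAl.

Fact onept_scaleAr (c : K) (u v : E) : c *: (u * v) = u * (c *: v).
Proof.
case: u v => [[a m] x] [[b n] y].
change (onept_scale c (onept_mul (a, m, x) (b, n, y)) =
        onept_mul (a, m, x) (onept_scale c (b, n, y))).
rewrite onept_mulE !onept_scaleE onept_mulE actDl !actA.
by rewrite mulr_algl !mulr_algr !scalerA mulrCA [a * c]mulrC scalerAr.
Qed.

HB.instance Definition _ := GRing.Lalgebra_isAlgebra.Build K E onept_scaleAr.

End OnePointExtension.

(* Main.v *)
(** Call X k-good if it has a finite resolution 0 -> C_n -> ... -> C_0 -> X -> 0
    with each C_i an (i + k)-th syzygy; then (i + k)-dell C_i = 0, so
    k-ddell X <= n.  The class of k-good modules is closed under extensions,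
    every module is 0-good, and the syzygies of a k-good module are
    (k + 1)-good.  Write A-modules as the A[M]-modules killed by the new
    idempotent.  Since A is local, its simple module T embeds in the projective
    A, so T is the syzygy of the A-module A/T; hence, by induction on k, T is
    k-good, and every A-module, being an iterated extension of copies of T, is
    k-good for every k.  The remaining simple A[M]-module is the quotient of
    A[M] by an A-module, and that A-module is (k + 1)-good. *)
From HB Require Import structures.
Require Import Defs.
From mathcomp Require Import all_boot all_order all_algebra all_field.
From mathcomp Require Import generic_quotient ring_quotient boolp.

Set Implicit Arguments.
Unset Strict Implicit.
Unset Printing Implicit Defensive.

Import GRing.Theory.
Local Open Scope ring_scope.

(** * Submodules, quotients and factorizations *)

Definition kernel (R : nzRingType) (U V : rmodType R) (f : U -> V) (u : U) : Prop :=
  f u = 0.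

Definition lin_image (R : nzRingType) (U V : rmodType R) (f : U -> V) (v : V) : Prop :=
  exists u, f u = v.

Section Toolkit.
Variable R : nzRingType.
Implicit Types U V W : rmodType R.

Lemma linear_of U V (f : U -> V) :
  (forall a u v, f (a *: u + v) = a *: f u + f v) ->
  exists h : {linear U -> V}, forall u, h u = f u.
Proof.
move=> lin_f; pose F := GRing.isLinear.Build _ _ _ _ f lin_f.
by pose h : {linear U -> V} := HB.pack f F; exists h.
Qed.

Section Sub.
Variables (V : rmodType R) (L : V -> Prop).

Definition submod_pred : {pred V} := fun v => `[< L v >].
Definition submod_type (_ : submodule L) := {v | submod_pred v}.
Variable subL : submodule L.
Local Notation S := (submod_type subL).

Fact submod_pred_closed : submod_closed submod_pred.
Proof.
case: subL => L0 Llin; split; first exact/asboolP.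
by move=> r u v /asboolP Lu /asboolP Lv; apply/asboolP/Llin.
Qed.

HB.instance Definition _ :=
  GRing.isSubmodClosed.Build _ V submod_pred submod_pred_closed.
HB.instance Definition _ := SubChoice.on S.
HB.instance Definition _ := [SubChoice_isSubZmodule of S by <:].
HB.instance Definition _ := [SubZmodule_isSubLmodule of S by <:].

Lemma sub_module : exists (Y : rmodType R) (i : {linear Y -> V}),
  injective i /\ forall v, L v <-> lin_image i v.
Proof.
exists S, (val : {linear S -> V}); split; first exact: val_inj.
move=> v; split=> [Lv|[[u Lu] <-]]; last exact/asboolP.
have Lv' : submod_pred v by apply/asboolP.
by exists (exist _ v Lv').
Qed.

Definition quot_type : Type := Quotient.quot submod_pred.
Local Notation Q := quot_type.
HB.instance Definition _ := GRing.Zmodule.on Q.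
Let pi : V -> Q := \pi_(Quotient.quot submod_pred)%qT.

Let pi_eq u v : (pi u = pi v) <-> submod_pred (u - v).
Proof.
by have := Quotient.idealrBE submod_pred u v => eq_uv; split=> [/eqP|?];
  [rewrite -eq_uv | apply/eqP; rewrite -eq_uv].
Qed.

Let piD : {morph pi : u v / u + v}.
Proof. by move=> u v; rewrite /pi Quotient.pi_add. Qed.

Let repr_pi u : exists2 v, submod_pred v & repr (pi u) = u + v.
Proof.
exists (repr (pi u) - u); last by rewrite addrC subrK.
by apply/pi_eq; rewrite /pi reprK.
Qed.

Definition quot_scale (r : R^c) (q : Q) : Q := pi (r *: (repr q : V)).

Let quot_scale_pi r u : quot_scale r (pi u) = pi (r *: u).
Proof.
rewrite /quot_scale; have [v Lv ->] := repr_pi u.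
by apply/pi_eq; rewrite scalerDr addrC addKr; apply: rpredZ.
Qed.

Let piP (q : Q) : exists u, q = pi u.
Proof. by exists (repr q); rewrite /pi reprK. Qed.

Fact quot_scaleA r s q : quot_scale r (quot_scale s q) = quot_scale (r * s) q.
Proof. by have [u ->] := piP q; rewrite !quot_scale_pi scalerA. Qed.
Fact quot_scale1 : left_id 1 quot_scale.
Proof. by move=> q; have [u ->] := piP q; rewrite quot_scale_pi scale1r. Qed.
Fact quot_scaleDr : right_distributive quot_scale +%R.
Proof.
move=> r q q'; have [u ->] := piP q; have [v ->] := piP q'.
by rewrite -piD !quot_scale_pi scalerDr piD.
Qed.
Fact quot_scaleDl q : {morph quot_scale^~ q : r s / r + s}.
Proof.
by move=> r s; have [u ->] := piP q; rewrite !quot_scale_pi scalerDl piD.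
Qed.

HB.instance Definition _ := GRing.Zmodule_isLmodule.Build R^c Q
  quot_scaleA quot_scale1 quot_scaleDr quot_scaleDl.

Lemma quot_module : exists (Y : rmodType R) (p : {linear V -> Y}),
  surjective p /\ forall v, L v <-> kernel p v.
Proof.
have [p pE] : exists p : {linear V -> Q}, forall u, p u = pi u.
  by apply: linear_of => r u v; rewrite piD -quot_scale_pi.
exists Q, p; split=> [q|v]; first by have [u ->] := piP q; exists u; rewrite pE.
have p0 : p 0 = pi 0 by rewrite pE.
rewrite /kernel -(linear0 p) p0 pE; split=> [Lv|/pi_eq].
  by apply/pi_eq; rewrite subr0; apply/asboolP.
by rewrite subr0 => /asboolP.
Qed.

End Sub.

Lemma factor_injective U V W (i : {linear V -> W}) (f : {linear U -> W}) :
  injective i -> (forall u, lin_image i (f u)) ->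
  exists h : {linear U -> V}, forall u, i (h u) = f u.
Proof.
move=> i_inj /choice[h hE]; have [|h' h'E] := @linear_of U V h.
  by move=> a u v; apply: i_inj; rewrite linearP !hE linearP.
by exists h' => u; rewrite h'E.
Qed.

Lemma factor_surjective U V W (p : {linear U -> V}) (f : {linear U -> W}) :
  surjective p -> (forall u, kernel p u -> kernel f u) ->
  exists h : {linear V -> W}, forall u, h (p u) = f u.
Proof.
move=> /choice[s sE] ker_sub.
have fs u : f (s (p u)) = f u.
  apply/eqP; rewrite -subr_eq0 -linearB; apply/eqP; apply: (ker_sub (s (p u) - u)).
  by rewrite /kernel linearB sE subrr.
have [|h hE] := @linear_of V W (f \o s); last first.
  by exists h => u; rewrite hE /= fs.
by move=> a u v; rewrite /= -linearP -[RHS]fs linearP !sE.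
Qed.

End Toolkit.

(** * Modules of finite length *)

Lemma exists_max (T : Type) (P : T -> Prop) (f : T -> nat) (n : nat) :
  (exists t, P t) -> (forall t, P t -> (f t <= n)%N) ->
  exists2 t, P t & forall t', P t' -> (f t' <= f t)%N.
Proof.
move=> [t0 Pt0] fn; pose Q m := `[< exists2 t, P t & f t = m >].
have exQ : exists m, Q m by exists (f t0); apply/asboolP; exists t0.
have Qn m : Q m -> (m <= n)%N by move=> /asboolP[t Pt <-]; exact: fn.
case: (ex_maxnP exQ Qn) => m /asboolP[t Pt <-] tmax.
by exists t => // t' Pt'; apply: tmax; apply/asboolP; exists t'.
Qed.

Lemma exists_min (T : Type) (P : T -> Prop) (f : T -> nat) :
  (exists t, P t) -> exists2 t, P t & forall t', P t' -> (f t <= f t')%N.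
Proof.
move=> [t0 Pt0]; pose Q m := `[< exists2 t, P t & f t = m >].
have exQ : exists m, Q m by exists (f t0); apply/asboolP; exists t0.
case: (ex_minnP exQ) => m /asboolP[t Pt <-] tmin.
by exists t => // t' Pt'; apply: tmin; apply/asboolP; exists t'.
Qed.

Section FiniteLength.
Variable R : nzRingType.
Implicit Types U V W : rmodType R.

Lemma submoduleZ V (L : V -> Prop) (r : R^c) v : submodule L -> L v -> L (r *: v).
Proof. by case=> L0 Llin Lv; rewrite -[r *: v]addr0; apply: Llin. Qed.

Lemma submoduleD V (L : V -> Prop) u v : submodule L -> L u -> L v -> L (u + v).
Proof. by case=> _ Llin Lu Lv; rewrite -[u]scale1r; apply: Llin. Qed.

Lemma submoduleB V (L : V -> Prop) u v : submodule L -> L u -> L v -> L (u - v).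
Proof. by case=> _ Llin Lu Lv; rewrite addrC -scaleN1r; apply: Llin. Qed.

Lemma submodule0 V : submodule (fun v : V => v = 0).
Proof. by split=> // r u v -> ->; rewrite scaler0 addr0. Qed.

Lemma submodule_full V : submodule (fun _ : V => True).
Proof. by []. Qed.

Lemma submodule_preim U V (f : {linear U -> V}) (L : V -> Prop) :
  submodule L -> submodule (fun u => L (f u)).
Proof.
case=> L0 Llin; split=> [|r u v Lu Lv]; first by rewrite linear0.
by rewrite linearP; apply: Llin.
Qed.

Lemma submodule_im U V (f : {linear U -> V}) (L : U -> Prop) :
  submodule L -> submodule (fun v => exists2 u, L u & f u = v).
Proof.
case=> L0 Llin; split=> [|r _ _ [u Lu <-] [v Lv <-]].
  by exists 0; rewrite ?linear0.
by exists (r *: u + v); [exact: Llin | rewrite linearP].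
Qed.

Lemma submodule_kernel U V (f : {linear U -> V}) : submodule (kernel f).
Proof. exact: submodule_preim (submodule0 V). Qed.

Lemma submodule_image U V (f : {linear U -> V}) : submodule (lin_image f).
Proof.
have := submodule_im f (submodule_full U); congr submodule.
by apply/funext => v; apply/propext; split=> -[u]; exists u.
Qed.

(* Finite length is encoded by a bounded, strictly monotone measure on
   submodules; this avoids composition series. *)
Definition strict_sub V (L L' : V -> Prop) : Prop :=
  (forall v, L v -> L' v) /\ exists2 v, L' v & ~ L v.

Definition length_measure V (mu : (V -> Prop) -> nat) : Prop :=
  forall L L', submodule L -> submodule L' -> strict_sub L L' ->
    (mu L < mu L')%N.

Definition length_le V (n : nat) : Prop :=
  exists2 mu : (V -> Prop) -> nat,
    length_measure mu & forall L, (mu L <= n)%N.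

Definition finite_length V : Prop := exists n, length_le V n.

Lemma sub_eqVstrict V (L L' : V -> Prop) :
  (forall v, L v -> L' v) -> L = L' \/ strict_sub L L'.
Proof.
move=> LL'; have [[v L'v nLv]|noex] := pselect (exists2 v, L' v & ~ L v).
  by right; split=> //; exists v.
left; apply/funext => v; apply/propext; split=> [/LL'//|L'v].
by have [//|nLv] := pselect (L v); case: noex; exists v.
Qed.

Lemma length_measure_le V (mu : (V -> Prop) -> nat) (L L' : V -> Prop) :
  length_measure mu -> submodule L -> submodule L' ->
  (forall v, L v -> L' v) -> (mu L <= mu L')%N.
Proof.
move=> mu_lt subL subL' /sub_eqVstrict[-> //|ltL].
by apply: ltnW; apply: mu_lt.
Qed.

Lemma finite_length_inj U V (i : {linear U -> V}) :
  injective i -> finite_length V -> finite_length U.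
Proof.
move=> i_inj [n [mu mu_lt mu_le]]; exists n.
exists (fun L => mu (fun v => exists2 u, L u & i u = v)) => // L L' sL sL'.
case=> LL' [u L'u nLu]; apply: mu_lt; try exact: submodule_im.
split=> [v [w Lw <-]|]; first by exists w; first exact: LL'.
by exists (i u); [exists u | case=> w Lw /i_inj wu; apply: nLu; rewrite -wu].
Qed.

Lemma length_le_quot U V (p : {linear U -> V}) n :
  surjective p -> (exists2 u, u <> 0 & p u = 0) -> length_le U n.+1 ->
  length_le V n.
Proof.
move=> p_surj [u u0 pu0] [mu mu_lt mu_le].
exists (fun L => (mu (fun u => L (p u))).-1) => [L L' sL sL' [LL' [v L'v nLv]]|L].
  have [w pw] := p_surj v.
  have lt0 : (0 < mu (fun u => L (p u)))%N.
    apply: (@leq_ltn_trans (mu (fun u => u = 0))) => //.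
    apply: mu_lt; [exact: submodule0|exact: submodule_preim|].
    split=> [_ ->|]; first by rewrite linear0; case: sL.
    by exists u => //; rewrite pu0; case: sL.
  have lt_mu : (mu (fun u => L (p u)) < mu (fun u => L' (p u)))%N.
    apply: mu_lt; try exact: submodule_preim.
    by split=> [x /LL'//|]; exists w; rewrite pw.
  by rewrite -ltnS prednK // prednK // (ltn_trans lt0).
by have := mu_le (fun u => L (p u)); case: (mu _).
Qed.

Lemma finite_length_surj U V (p : {linear U -> V}) :
  surjective p -> finite_length U -> finite_length V.
Proof.
move=> p_surj [n [mu mu_lt mu_le]]; exists n.
exists (fun L => mu (fun u => L (p u))) => // L L' sL sL' [LL' [v L'v nLv]].
have [w pw] := p_surj v; apply: mu_lt; try exact: submodule_preim.
by split=> [x /LL'//|]; exists w; rewrite pw.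
Qed.

Lemma finite_length_ext U V W (i : {linear U -> V}) (p : {linear V -> W}) :
  (forall v, kernel p v -> lin_image i v) ->
  finite_length U -> finite_length W -> finite_length V.
Proof.
move=> ker_im [m [mu mu_lt mu_le]] [n [nu nu_lt nu_le]]; exists (m + n)%N.
exists (fun L => mu (fun u => L (i u)) + nu (fun w => exists2 v, L v & p v = w))%N;
  last by move=> L; apply: leq_add.
move=> L L' sL sL' [LL' [v L'v nLv]].
have mu_mono : (mu (fun u => L (i u)) <= mu (fun u => L' (i u)))%N.
  by apply: length_measure_le => //; (try exact: submodule_preim) => u /LL'.
have im_sub w : (exists2 v, L v & p v = w) -> exists2 v, L' v & p v = w.
  by case=> x /LL' L'x <-; exists x.
have nu_mono : (nu (fun w => exists2 v, L v & p v = w) <=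
                nu (fun w => exists2 v, L' v & p v = w))%N.
  by apply: length_measure_le => //; exact: submodule_im.
have [[w Lw pwv]|npv] := pselect (exists2 w, L w & p w = p v).
  have [u iu] : lin_image i (v - w).
    by apply: ker_im; rewrite /kernel linearB pwv subrr.
  have lt_mu : (mu (fun u => L (i u)) < mu (fun u => L' (i u)))%N.
    apply: mu_lt; try exact: submodule_preim.
    split=> [x /LL'//|]; exists u; rewrite iu.
      by apply: submoduleB => //; apply: LL'.
    by move=> Lvw; apply: nLv; rewrite -(subrK w v); apply: submoduleD.
  by rewrite -addSn; apply: leq_add.
rewrite -addnS; apply: leq_add => //.
apply: nu_lt; try exact: submodule_im.
by split=> //; exists (p v) => //; exists v.
Qed.

Lemma finite_length_prod U V :
  finite_length U -> finite_length V -> finite_length (U * V)%type.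
Proof.
have [|i iE] := @linear_of R U (U * V)%type (fun u => (u, 0)).
  by move=> a u v; congr (_, _); rewrite /= scaler0 addr0.
have [|p pE] := @linear_of R (U * V)%type V snd; first by [].
apply: (@finite_length_ext _ _ _ i p) => -[u v]; rewrite /kernel pE /= => ->.
by exists u; rewrite iE.
Qed.

Lemma finitely_generated_finite_length V :
  finite_length (R^c^o : rmodType R) -> finitely_generated V -> finite_length V.
Proof.
move=> finR [n [g gP]]; elim: n V g gP => [|n IHn] V g gP.
  exists 0%N, (fun=> 0%N) => // L L' [L0 _] _ [_ [v _ []]].
  by have [c ->] := gP v; rewrite big_ord0.
pose L v := exists c : 'I_n -> R^c, v = \sum_i c i *: g (lift ord0 i).
have sL : submodule L.
  split=> [|r _ _ [c ->] [d ->]].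
    by exists (fun=> 0); rewrite big1 // => i _; rewrite scale0r.
  exists (fun i => r * c i + d i); rewrite scaler_sumr -big_split /=.
  by apply: eq_bigr => i _; rewrite scalerDl scalerA.
have [U [i [i_inj LE]]] := sub_module sL.
have gU j : lin_image i (g (lift ord0 j)).
  apply/LE; exists (fun k => (k == j)%:R); rewrite (bigD1 j) //= eqxx scale1r.
  by rewrite big1 ?addr0 // => k /negPf->; rewrite scale0r.
have [h hE] := choice gU.
have finU : finite_length U.
  apply: (IHn _ h) => u; have [|c cE] := (LE (i u)).2 _; first by exists u.
  exists c; apply: i_inj; rewrite cE linear_sum; apply: eq_bigr => j _.
  by rewrite linearZ hE.
have [|p pE] := @linear_of R (R^c^o * U)%type V
  (fun x => (x.1 : R^c) *: g ord0 + i x.2).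
  move=> a [r u] [s v] /=; rewrite scalerDl linearP scalerDr addrACA.
  by rewrite -scalerA.
apply: (finite_length_surj (p := p)) (finite_length_prod finR finU) => v.
have [c ->] := gP v; rewrite big_ord_recl.
have [|u uE] := (LE (\sum_(j < n) c (lift ord0 j) *: g (lift ord0 j))).1 _.
  by exists (fun j => c (lift ord0 j)).
by exists (c ord0, u); rewrite pE /= uE.
Qed.

Lemma finite_length_finitely_generated V :
  finite_length V -> finitely_generated V.
Proof.
move=> [n [mu mu_lt mu_le]].
pose span (s : seq V) v := exists c : nat -> R^c, v = \sum_(i < size s) c i *: s`_i.
have sub_span s : submodule (span s).
  split=> [|r _ _ [c ->] [d ->]].
    by exists (fun=> 0); rewrite big1 // => i _; rewrite scale0r.
  exists (fun i => r * c i + d i); rewrite scaler_sumr -big_split /=.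
  by apply: eq_bigr => i _; rewrite scalerDl scalerA.
have [||s _ smax] := @exists_max _ (fun=> True) (fun s => mu (span s)) n.
- by exists [::].
- by [].
exists (size s), (fun i => s`_i) => v.
have [[c cE]|nsv] := pselect (span s v); first by exists (fun i => c i).
have /smax : True by []. move=> /(_ (v :: s)); rewrite leqNgt => /negP[].
apply: mu_lt => //; split=> [w [c ->]|].
  exists (fun i => if i is j.+1 then c j else 0).
  by rewrite big_ord_recl scale0r add0r; apply: eq_bigr.
exists v => //; exists (fun i => (i == 0)%N%:R).
rewrite big_ord_recl scale1r big1 ?addr0 // => i _.
by rewrite scale0r.
Qed.

Lemma surjective_endo_injective V (f : {linear V -> V}) :
  finite_length V -> surjective f -> injective f.
Proof.
move=> [n [mu mu_lt mu_le]] f_surj.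
have sub_ker i : submodule (fun v => iter i f v = 0).
  elim: i => [|i IHi]; first exact: submodule0.
  have := submodule_preim f IHi; congr submodule; apply/funext => v.
  by rewrite -iterSr.
have iter_surj i v : exists w, iter i f w = v.
  elim: i v => [|i IHi] v; first by exists v.
  by have [w <-] := f_surj v; have [x <-] := IHi w; exists x.
have [||i _ imax] := @exists_max _ (fun=> True)
  (fun i => mu (fun v => iter i f v = 0)) n.
- by exists 0%N.
- by [].
have ker0 v : f v = 0 -> v = 0.
  move=> fv0; have [w wE] := iter_surj i v.
  have /imax : True by []. move=> /(_ i.+1); rewrite leqNgt => /negP H.
  have [//|v0] := pselect (v = 0); case: H; apply: mu_lt => //.
  split=> [x|]; first by rewrite iterS => ->; rewrite linear0.
  by exists w; rewrite ?iterS wE.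
move=> u v fuv; apply/eqP; rewrite -subr_eq0; apply/eqP/ker0.
by rewrite linearB fuv subrr.
Qed.

End FiniteLength.

(** * Projective modules and projective covers *)

Section LinearMaps.
Variable R : nzRingType.
Implicit Types U V W P Q : rmodType R.

Definition short_exact U V W (i : U -> V) (p : V -> W) : Prop :=
  [/\ injective i, exact_at i p & surjective p].

Lemma linear_injective U V (f : {linear U -> V}) :
  (forall u, f u = 0 -> u = 0) -> injective f.
Proof.
move=> f0 u v fuv; apply/eqP; rewrite -subr_eq0; apply/eqP/f0.
by rewrite linearB fuv subrr.
Qed.

Lemma linear_copair U V W (f : {linear U -> W}) (g : {linear V -> W}) :
  exists h : {linear (U * V)%type -> W}, forall u v, h (u, v) = f u + g v.
Proof.
have [|h hE] := @linear_of R (U * V)%type W (fun x => f x.1 + g x.2).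
  by move=> a [u v] [u' v'] /=; rewrite !linearP scalerDr addrACA.
by exists h => u v; rewrite hE.
Qed.

Lemma linear_pair U V W (f : {linear U -> V}) (g : {linear U -> W}) :
  exists h : {linear U -> (V * W)%type}, forall u, h u = (f u, g u).
Proof. by apply: linear_of => a u v; rewrite !linearP. Qed.

Lemma linear_id V : exists h : {linear V -> V}, forall v, h v = v.
Proof. by apply: linear_of. Qed.

Lemma linear_zero U V : exists h : {linear U -> V}, forall u, h u = 0.
Proof. by apply: linear_of => a u v; rewrite scaler0 addr0. Qed.

Lemma linear_comp U V W (f : {linear V -> W}) (g : {linear U -> V}) :
  exists h : {linear U -> W}, forall u, h u = f (g u).
Proof. by apply: linear_of => a u v; rewrite !linearP. Qed.

Lemma linear_fst U V W (f : {linear U -> (V * W)%type}) :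
  exists h : {linear U -> V}, forall u, h u = (f u).1.
Proof. by apply: linear_of => a u v; rewrite linearP. Qed.

Lemma linear_snd U V W (f : {linear U -> (V * W)%type}) :
  exists h : {linear U -> W}, forall u, h u = (f u).2.
Proof. by apply: linear_of => a u v; rewrite linearP. Qed.

Definition retract U V : Prop :=
  exists (a : {linear U -> V}) (b : {linear V -> U}), forall u, b (a u) = u.

Lemma retract_summand U V : retract U V -> summand U V.
Proof.
move=> [a [b ba]].
have [W [i [i_inj iE]]] := sub_module (submodule_kernel b).
have [h hE] := linear_copair a i; exists W, h.
have [g gE] : exists g : {linear V -> W}, forall v, i (g v) = v - a (b v).
  have [|f fE] := @linear_of R V V (fun v => v - a (b v)).
    by move=> r u v; rewrite !linearP scalerDr addrACA.
  have [|g gE] := @factor_injective R V W V i f i_inj; last first.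
    by exists g => v; rewrite gE fE.
  by move=> v; apply/iE; rewrite /kernel fE linearB ba subrr.
have bi w : b (i w) = 0 by apply/iE; exists w.
exists (fun v => (b v, g v)) => [[u w]|v]; last by rewrite hE gE addrC subrK.
have bh : b (h (u, w)) = u by rewrite hE linearD ba bi addr0.
by rewrite bh; congr (_, _); apply: i_inj; rewrite gE bh hE addrC addKr.
Qed.

Lemma projective_retract P Q : projective P -> retract Q P -> projective Q.
Proof.
move=> projP [a [b ba]] U W g f g_surj; have [fb fbE] := linear_comp f b.
have [h hE] := projP U W g fb g_surj; have [ha haE] := linear_comp h a.
by exists ha => v; rewrite haE hE fbE ba.
Qed.

Lemma projective_prod P Q : projective P -> projective Q -> projective (P * Q)%type.
Proof.
move=> projP projQ U W g f g_surj.
have [f1 f1E] : exists f1 : {linear P -> W}, forall x, f1 x = f (x, 0).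
  apply: linear_of => a u v; rewrite -linearP; congr (f _).
  by congr (_, _); rewrite /= scaler0 addr0.
have [f2 f2E] : exists f2 : {linear Q -> W}, forall x, f2 x = f (0, x).
  apply: linear_of => a u v; rewrite -linearP; congr (f _).
  by congr (_, _); rewrite /= scaler0 addr0.
have [h1 h1E] := projP _ _ _ f1 g_surj; have [h2 h2E] := projQ _ _ _ f2 g_surj.
have [h hE] := linear_copair h1 h2; exists h => -[x y].
rewrite hE linearD h1E h2E f1E f2E -linearD; congr (f _).
by congr (_, _); rewrite /= ?addr0 ?add0r.
Qed.

Lemma projective_rV n : projective ('rV[R^c]_n : rmodType R).
Proof.
move=> U W g f /choice[s sE].
have [|h hE] := @linear_of R 'rV[R^c]_n U
    (fun v => \sum_j v 0 j *: s (f (delta_mx 0 j))).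
  move=> a u v; rewrite scaler_sumr -big_split; apply: eq_bigr => j _ /=.
  by rewrite !mxE scalerDl scalerA.
exists h => v; rewrite hE {2}(row_sum_delta v) !linear_sum.
by apply: eq_bigr => j _; rewrite !linearZ sE.
Qed.

Lemma projective_zero V : (forall v : V, v = 0) -> projective V.
Proof.
move=> V0 U W g f _; have [h hE] := linear_zero V U.
by exists h => v; rewrite hE linear0 (V0 v) linear0.
Qed.

End LinearMaps.

Section FgModules.
Variable R : nzRingType.
Hypothesis finR : finite_length (R^c^o : rmodType R).
Implicit Types X Y Z C P Q E N : fgmod R.

Lemma fgmod_finite_length X : finite_length X.
Proof. exact: finitely_generated_finite_length (fgmodP X). Qed.

Lemma sub_fgmod X (L : X -> Prop) : submodule L ->
  exists Y (i : {linear Y -> X}), injective i /\ forall x, L x <-> lin_image i x.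
Proof.
move=> /sub_module[Y [i [i_inj iE]]].
have fgY : finitely_generated Y.
  apply: finite_length_finitely_generated.
  exact: finite_length_inj i_inj (fgmod_finite_length X).
by exists (FGMod fgY), i.
Qed.

Lemma finitely_generated_surj (U V : rmodType R) (p : {linear U -> V}) :
  surjective p -> finitely_generated U -> finitely_generated V.
Proof.
move=> p_surj [n [g gP]]; exists n, (fun i => p (g i)) => v.
have [u <-] := p_surj v; have [c ->] := gP u; exists c.
by rewrite linear_sum; apply: eq_bigr => i _; rewrite linearZ.
Qed.

Lemma quot_fgmod X (L : X -> Prop) : submodule L ->
  exists Y (p : {linear X -> Y}), surjective p /\ forall x, L x <-> kernel p x.
Proof.
move=> /quot_module[Y [p [p_surj pE]]].
by exists (FGMod (finitely_generated_surj p_surj (fgmodP X))), p.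
Qed.

Fact fgprod_subproof X Y : finitely_generated (X * Y)%type.
Proof.
apply: finite_length_finitely_generated.
exact: finite_length_prod (fgmod_finite_length X) (fgmod_finite_length Y).
Qed.

Definition fgprod X Y : fgmod R := FGMod (fgprod_subproof X Y).

Fact fgfree_subproof n : finitely_generated ('rV[R^c]_n : rmodType R).
Proof.
exists n, (fun i => delta_mx 0 i) => v; exists (fun i => v 0 i).
exact: row_sum_delta.
Qed.

Definition fgfree n : fgmod R := FGMod (fgfree_subproof n).

Lemma fgfree0 (x : fgfree 0) : x = 0.
Proof. exact: thinmx0. Qed.

Lemma free_cover X :
  exists P (p : {linear P -> X}), projective P /\ surjective p.
Proof.
have [n [g gP]] := fgmodP X; exists (fgfree n).
have [|p pE] := @linear_of R 'rV[R^c]_n X (fun v => \sum_j v 0 j *: g j).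
  move=> a u v; rewrite scaler_sumr -big_split; apply: eq_bigr => j _ /=.
  by rewrite !mxE scalerDl scalerA.
exists p; split=> [|x]; first exact: projective_rV.
have [c ->] := gP x; exists (\row_j c j); rewrite pE.
by apply: eq_bigr => j _; rewrite mxE.
Qed.

Lemma kernel_fgmod X (V : rmodType R) (f : {linear X -> V}) :
  exists Y (i : {linear Y -> X}), injective i /\ exact_at i f.
Proof. exact: sub_fgmod (submodule_kernel f). Qed.

(* A submodule of a free cover that is minimal among those still mapping onto
   [X] is a retract of it, because a surjective endomorphism of a module of
   finite length is injective. *)
Lemma projective_cover_exists X :
  exists Q (p : {linear Q -> X}), projective_cover p.
Proof.
have [P [p [projP p_surj]]] := free_cover X.
have [n [mu mu_lt mu_le]] := fgmod_finite_length P.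
pose covers (L : P -> Prop) := forall x, exists2 u, L u & p u = x.
have [|L [sL covL] Lmin] :=
    @exists_min _ (fun L => submodule L /\ covers L) mu.
  by exists (fun=> True); split=> // x; have [u <-] := p_surj x; exists u.
have Leq L' : submodule L' -> covers L' -> (forall u, L' u -> L u) ->
    forall u, L u -> L' u.
  move=> sL' covL' /sub_eqVstrict[-> //|L'L].
  have /Lmin : submodule L' /\ covers L' by [].
  by rewrite leqNgt mu_lt.
have [Q [j [j_inj jE]]] := sub_fgmod sL.
have jL q : L (j q) by apply/jE; exists q.
have [q qE] := linear_comp p j; exists Q, q.
have q_surj : surjective q.
  move=> x; have [u /jE[v <-] <-] := covL x; exists v; exact: qE.
have [h hE] := projP _ _ q p q_surj.
have [f fE] := linear_comp h j.
have f_surj : surjective f.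
  have [jf jfE] := linear_comp j f => v.
  have /Leq-/(_ _ _ _ (jL v)) : submodule (lin_image jf) by exact: submodule_image.
  case=> [x|_ [w <-]|w]; last by rewrite jfE => /j_inj; exists w.
    have [w <-] := q_surj x; exists (jf w); first by exists w.
    by rewrite jfE -qE fE hE -qE.
  by rewrite jfE.
have f_inj := surjective_endo_injective (fgmod_finite_length Q) f_surj.
have [r rE] := factor_injective f_inj (f := h) (fun u => f_surj (h u)).
split=> // [|L' sL' L'P v].
  apply: projective_retract projP _; exists j, r => v.
  by apply: f_inj; rewrite rE fE.
have /Leq-/(_ _ _ _ (jL v)) := submodule_im j sL'.
case=> [x|_ [w L'w <-] //|w L'w /j_inj <- //].
have [w <-] := q_surj x; have [k [l [qk L'l ->]]] := L'P w.
by exists (j l); [exists l | rewrite linearD qk add0r qE].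
Qed.

End FgModules.

(** * Syzygies and good modules *)

Section Syzygies.
Variable R : nzRingType.
Hypothesis finR : finite_length (R^c^o : rmodType R).
Implicit Types X Y Z C P Q E K N O W : fgmod R.

(* Not necessarily minimal syzygies; [syz_retract] below compares them with
   the minimal ones of [nsyzygy]. *)
Fixpoint syz (k : nat) X : Prop :=
  if k is k'.+1 then
    exists P C (i : {linear X -> P}) (p : {linear P -> C}),
      [/\ projective P, short_exact i p & syz k' C]
  else True.

Inductive good : nat -> fgmod R -> Prop :=
| good_syz k X of syz k X : good k X
| good_step k X C Y (i : {linear Y -> C}) (p : {linear C -> X}) of
    syz k C & short_exact i p & good k.+1 Y : good k X.

Lemma good_cases k X : good k X ->
  syz k X \/ exists C Y (i : {linear Y -> C}) (p : {linear C -> X}),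
    [/\ syz k C, short_exact i p & good k.+1 Y].
Proof. by case=> [|{}k {}X C Y i p syzC ex goodY]; [left | right; exists C, Y, i, p]. Qed.

Lemma syz_projective k P : projective P -> syz k P.
Proof.
elim: k P => // k IHk P projP; have [i iE] := linear_id P.
have [p pE] := linear_zero P (fgfree R 0).
exists P, (fgfree R 0), i, p; split=> //; last first.
  by apply: IHk; apply: projective_zero; exact: fgfree0.
split=> [u v|x|x]; first by rewrite !iE.
  by rewrite pE; split=> // _; exists x; rewrite iE.
by exists 0; rewrite pE [RHS]fgfree0.
Qed.

Lemma syz_prod_projective k X Q :
  syz k X -> projective Q -> syz k (fgprod finR X Q).
Proof.
case: k => // k [P [C [i [p [projP [i_inj ex p_surj] syzC]]]]] projQ.
have [|j jE] := @linear_of R (X * Q)%type (P * Q)%type (fun x => (i x.1, x.2)).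
  by move=> a u v /=; rewrite linearP.
have [|q qE] := @linear_of R (P * Q)%type C (fun x => p x.1).
  by move=> a u v /=; rewrite linearP.
exists (fgprod finR P Q), C, j, q; split=> //.
  exact: (projective_prod (P := P) (Q := Q)).
split=> [[x1 x2] [y1 y2]|[x y]|c].
- by rewrite !jE /= => -[/i_inj-> ->].
- rewrite qE /=; split=> [/ex[z <-]|[[z t]]]; first by exists (z, y); rewrite jE.
  by rewrite jE /= => -[<- _]; apply/ex; exists z.
- by have [x <-] := p_surj c; exists (x, 0); rewrite qE.
Qed.

Lemma extension_cover X1 E C C1 P (i : {linear X1 -> E}) (p : {linear E -> C})
    (q : {linear C1 -> X1}) (pi : {linear P -> C}) :
  short_exact i p -> surjective q -> projective P -> surjective pi ->
  exists K O (j : {linear K -> fgprod finR C1 P}) (t : {linear fgprod finR C1 P -> E})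
         (m : {linear O -> P}) (s : {linear K -> O}),
  [/\ short_exact j t, short_exact m pi, surjective s,
      forall c, q c = 0 -> lin_image j (c, 0) &
      forall z, s z = 0 <-> exists2 c, q c = 0 & j z = (c, 0)].
Proof.
move=> [i_inj ex p_surj] q_surj projP pi_surj.
have [g gE] := projP _ _ p pi p_surj.
have [iq iqE] := linear_comp i q.
have [t tE] := linear_copair iq g.
have [K [j [j_inj jE]]] := @kernel_fgmod _ finR (fgprod finR C1 P) _ t.
have [O [m [m_inj mE]]] := kernel_fgmod finR pi.
have [j2 j2E] := linear_snd j.
have piq c : p (i (q c)) = 0 by apply/ex; exists (q c).
have jt z : i (q (j z).1) + g (j z).2 = 0.
  by rewrite -iqE -tE -surjective_pairing; apply/jE; exists z.
have [|s sE] := factor_injective (f := j2) m_inj.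
  move=> z; apply/mE; rewrite j2E -gE.
  by have /(congr1 p) := jt z; rewrite linearD piq add0r linear0.
exists K, O, j, t, m, s; split=> // [|o|c qc0|z].
- split=> // e; have [x xE] := pi_surj (p e).
  have [|x1 x1E] := (ex (e - g x)).1 _; first by rewrite linearB gE xE subrr.
  by have [c cE] := q_surj x1; exists (c, x); rewrite tE iqE cE x1E subrK.
- have [|x1 x1E] := (ex (g (m o))).1 _; first by rewrite gE; apply/mE; exists o.
  have [c cE] := q_surj x1; have [|z zE] := (jE (- c, m o)).1 _.
    by rewrite tE linearN iqE cE x1E addNr.
  by exists z; apply: m_inj; rewrite sE j2E zE.
- by apply/jE; rewrite tE iqE qc0 !linear0 addr0.
- split=> [sz0|[c qc jz]]; last by apply: m_inj; rewrite sE j2E jz linear0.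
  have jz2 : (j z).2 = 0 by rewrite -j2E -sE sz0 linear0.
  exists (j z).1; last by rewrite [LHS]surjective_pairing jz2.
  by apply: i_inj; have := jt z; rewrite jz2 !linear0 addr0.
Qed.

Lemma good_ext_syz k X1 E C (i : {linear X1 -> E}) (p : {linear E -> C}) :
  good k X1 -> syz k C -> short_exact i p -> good k E.
Proof.
move=> goodX1; elim: goodX1 E C i p => {k X1} [k X1 syzX1|k X1 C1 Y1 i1 q syzC1];
  last move=> [i1_inj ex1 q_surj] _ IH;
  move=> E C i p syzC exE; have [P [pi [projP pi_surj]]] := free_cover C.
  have [q qE] := linear_id X1.
  have q_surj : surjective q by move=> x; exists x; rewrite qE.
  have [K [O [j [t [m [s [exj [m_inj exm _] s_surj _ s_ker]]]]]]] :=
    extension_cover exE q_surj projP pi_surj.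
  apply: (good_step _ exj); first exact: syz_prod_projective.
  have [ms msE] := linear_comp m s.
  apply: good_syz; exists P, C, ms, pi; split=> //; split=> // [|x].
    apply: linear_injective => z; rewrite msE -[RHS](linear0 m) => /m_inj/s_ker[c].
    rewrite qE => -> jz0; have [j_inj _ _] := exj.
    by apply: j_inj; rewrite linear0 jz0.
  split=> [/exm[o <-]|[z <-]]; last by apply/exm; exists (s z); rewrite msE.
  by have [z <-] := s_surj o; exists z; rewrite msE.
have [K [O [j [t [m [s [exj exm s_surj im_j s_ker]]]]]]] :=
  extension_cover exE q_surj projP pi_surj.
apply: (good_step _ exj); first exact: syz_prod_projective.
have [f fE] : exists f : {linear Y1 -> fgprod finR C1 P}, forall y, f y = (i1 y, 0).
  have [o oE] := linear_zero Y1 P; have [f fE] := linear_pair i1 o.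
  by exists f => y; rewrite fE oE.
have [j_inj _ _] := exj.
have [|r rE] := factor_injective (f := f) j_inj.
  by move=> y; rewrite fE; apply: im_j; apply/ex1; exists y.
apply: (IH K O r s); first by exists P, C, m, pi.
split=> // [|z].
  apply: linear_injective => y ry; apply: i1_inj.
  by have := rE y; rewrite ry linear0 fE linear0 => -[].
split=> [/s_ker[c /ex1[y <-] jz]|[y <-]].
  by exists y; apply: j_inj; rewrite rE fE jz.
by apply/s_ker; exists (i1 y); [apply/ex1; exists y | rewrite rE fE].
Qed.

Lemma good_ext k X1 X X2 (i : {linear X1 -> X}) (p : {linear X -> X2}) :
  good k X1 -> good k X2 -> short_exact i p -> good k X.
Proof.
move=> goodX1 goodX2.
elim: goodX2 X1 X i p goodX1 => {k X2} [k X2 syzX2|k X2 C2 Y2 i2 q syzC2].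
  by move=> X1 X i p goodX1; apply: good_ext_syz.
move=> [i2_inj ex2 q_surj] goodY2 IH X1 X i p goodX1 [i_inj ex p_surj].
have [f fE] : exists f : {linear fgprod finR X C2 -> X2},
    forall x, f x = p x.1 - q x.2.
  apply: linear_of => a u v; rewrite !linearP /=.
  by rewrite scalerDr addrACA.
have [E [j [j_inj jE]]] := kernel_fgmod finR f.
have jP e : p (j e).1 = q (j e).2.
  by apply/eqP; rewrite -subr_eq0 -fE; apply/eqP/jE; exists e.
have [ix ixE] : exists ix : {linear X1 -> fgprod finR X C2}, forall x, ix x = (i x, 0).
  have [o oE] := linear_zero X1 C2; have [g gE] := linear_pair i o.
  by exists g => y; rewrite gE oE.
have [iy iyE] : exists iy : {linear Y2 -> fgprod finR X C2}, forall y, iy y = (0, i2 y).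
  have [o oE] := linear_zero Y2 X; have [g gE] := linear_pair o i2.
  by exists g => y; rewrite gE oE.
have pi0 x : p (i x) = 0 by apply/ex; exists x.
have qi0 y : q (i2 y) = 0 by apply/ex2; exists y.
have [|a aE] := factor_injective (f := ix) j_inj.
  by move=> x; apply/jE; rewrite fE ixE /= pi0 linear0 subr0.
have [|b bE] := factor_injective (f := iy) j_inj.
  by move=> x; apply/jE; rewrite fE iyE /= linear0 qi0 subr0.
have [j1 j1E] := linear_fst j; have [j2 j2E] := linear_snd j.
have pullback x c : p x = q c -> lin_image j (x, c).
  by move=> pq; apply/jE; rewrite fE pq subrr.
have goodE : good k E.
  apply: (@good_ext_syz k X1 E C2 a j2) => //; split=> [|e|c].
  - by move=> u v auv; apply: i_inj; have := aE u; rewrite auv aE !ixE => -[].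
  - rewrite j2E; split=> [je2|[x <-]]; last by rewrite aE ixE.
    have [|x xE] := (ex (j e).1).1 _; first by rewrite jP je2 linear0.
    by exists x; apply: j_inj; rewrite aE ixE xE -je2 -surjective_pairing.
  - have [x xE] := p_surj (q c); have [e eE] := pullback _ _ xE.
    by exists e; rewrite j2E eE.
have exb : short_exact b j1.
  split=> [|e|x].
  - by move=> u v buv; apply: i2_inj; have := bE u; rewrite buv bE !iyE => -[].
  - rewrite j1E; split=> [je1|[x <-]]; last by rewrite bE iyE.
    have [|y yE] := (ex2 (j e).2).1 _; first by rewrite -jP je1 linear0.
    by exists y; apply: j_inj; rewrite bE iyE yE -je1 -surjective_pairing.
  - have [c cE] := q_surj (p x); have [e eE] := pullback _ _ (esym cE).
    by exists e; rewrite j1E eE.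
have [syzE|[C' [Y' [i' [q' [syzC' [i'_inj ex' q'_surj] goodY']]]]]] := good_cases goodE.
  by case: exb => b_inj exb j1_surj; apply: (good_step syzE (i := b) (p := j1)) => //.
case: exb => b_inj exb j1_surj.
have [c cE] := linear_comp j1 q'.
have [K [l [l_inj lE]]] := kernel_fgmod finR c.
have [|y yE] := factor_injective (f := i') l_inj.
  by move=> y; apply/lE; rewrite cE (_ : q' _ = 0) ?linear0 //; apply/ex'; exists y.
have [ql qlE] := linear_comp q' l.
have [|z zE] := factor_injective (f := ql) b_inj.
  by move=> k'; apply/exb; rewrite qlE -cE; apply/lE; exists k'.
have goodK : good k.+1 K.
  apply: (IH Y' K y z) => //; split=> [u v yuv|u|v].
  - by apply: i'_inj; rewrite -!yE yuv.
  - split=> [zu0|[v <-]].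
      have [|v vE] := (ex' (l u)).1 _; first by rewrite -qlE -zE zu0 linear0.
      by exists v; apply: l_inj; rewrite yE.
    by apply: b_inj; rewrite zE qlE yE linear0; apply/ex'; exists v.
  - have [w wE] := q'_surj (b v).
    have [|u uE] := (lE w).1 _; first by rewrite cE wE; apply/exb; exists v.
    by exists u; apply: b_inj; rewrite zE qlE uE.
apply: (good_step syzC' _ goodK (i := l) (p := c)); split=> // x.
have [e <-] := j1_surj x; have [w <-] := q'_surj e.
by exists w; rewrite cE.
Qed.

Lemma good_syzygy k X P Y (i : {linear Y -> P}) (p : {linear P -> X}) :
  good k X -> projective P -> short_exact i p -> good k.+1 Y.
Proof.
move=> goodX; elim: goodX P Y i p => {k X} [k X syzX|k X C Y1 i1 q syzC].
  by move=> P Y i p projP exY; apply: good_syz; exists P, X, i, p.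
move=> [i1_inj ex1 q_surj] _ IH P Y i p projP [i_inj ex p_surj].
have [g gE] := projP _ _ q p q_surj.
have [Q [r [projQ r_surj]]] := free_cover Y1.
have [ir irE] := linear_comp i1 r.
have [t tE] := linear_copair g ir.
have [Z [j [j_inj jE]]] := @kernel_fgmod _ finR (fgprod finR P Q) _ t.
have [W [m [m_inj mE]]] := kernel_fgmod finR r.
have [j1 j1E] := linear_fst j.
have jt z : g (j z).1 + i1 (r (j z).2) = 0.
  by rewrite -irE -tE -surjective_pairing; apply/jE; exists z.
have qi1 y : q (i1 y) = 0 by apply/ex1; exists y.
have [|s sE] := factor_injective (f := j1) i_inj.
  move=> z; apply/ex; rewrite j1E -gE.
  by have /(congr1 q) := jt z; rewrite linearD qi1 addr0 linear0.
have [f fE] : exists f : {linear W -> fgprod finR P Q}, forall w, f w = (0, m w).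
  have [o oE] := linear_zero W P; have [f fE] := linear_pair o m.
  by exists f => y; rewrite fE oE.
have [|b bE] := factor_injective (f := f) j_inj.
  move=> w; apply/jE; rewrite fE tE irE (_ : r _ = 0) ?linear0 ?addr0 //.
  by apply/mE; exists w.
have syzZ : syz k.+1 Z.
  exists (fgprod finR P Q), C, j, t; split=> //.
    exact: (projective_prod (P := P) (Q := Q)).
  split=> // c; have [x xE] := p_surj (q c).
  have [|y yE] := (ex1 (c - g x)).1 _; first by rewrite linearB gE xE subrr.
  by have [z zE] := r_surj y; exists (x, z); rewrite tE irE zE yE addrC subrK.
have goodW : good k.+2 W by apply: (IH Q W m r).
apply: (good_step syzZ _ goodW (i := b) (p := s)); split=> [u v buv|z|y].
- by have := bE u; rewrite buv bE !fE => -[] /m_inj.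
- split=> [sz0|[w <-]]; last first.
    by apply: i_inj; rewrite sE j1E bE fE linear0.
  have jz1 : (j z).1 = 0 by rewrite -j1E -sE sz0 linear0.
  have [|w wE] := (mE (j z).2).1 _.
    by apply: i1_inj; have := jt z; rewrite jz1 !linear0 add0r.
  by exists w; apply: j_inj; rewrite bE fE wE -jz1 -surjective_pairing.
- have [|y1 y1E] := (ex1 (g (i y))).1 _; first by rewrite gE; apply/ex; exists y.
  have [x xE] := r_surj y1; have [|z zE] := (jE (i y, - x)).1 _.
    by rewrite tE linearN irE xE y1E subrr.
  by exists z; apply: i_inj; rewrite sE j1E zE.
Qed.

Lemma syz_retract k C : syz k C ->
  exists N Z P, [/\ nsyzygy k N Z, projective P & retract C (Z * P)%type].
Proof.
elim: k C => [|k IHk] C.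
  move=> _; exists C, C, (fgfree R 0); split.
  - by have [h hE] := linear_id C; exists h, h => x; rewrite !hE.
  - by apply: projective_zero; apply: fgfree0.
  have [a aE] := linear_id C; have [o oE] := linear_zero C (fgfree R 0).
  have [f fE] := linear_pair a o; have [j jE] := linear_id (C * fgfree R 0)%type.
  have [g gE] := linear_fst j.
  by exists f, g => x; rewrite gE jE fE aE.
move=> [P [D [i [p [projP [i_inj ex p_surj] /IHk[N [Z [Q [omegaZ projQ]]]]]]]]].
move=> [a [b ba]].
have [PZ [q pcq]] := projective_cover_exists finR Z; have [projPZ q_surj _] := pcq.
have [Z' [m [m_inj mE]]] := kernel_fgmod finR q.
exists N, Z', P; split=> //; first by exists Z; split=> //; exists PZ, q, m.
have [r rE] : exists r : {linear (PZ * Q)%type -> (Z * Q)%type},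
    forall x, r x = (q x.1, x.2).
  by apply: linear_of => c u v /=; rewrite linearP.
have r_surj : surjective r.
  by move=> [z y]; have [x <-] := q_surj z; exists (x, y); rewrite rE.
have [ap apE] := linear_comp a p; have [br brE] := linear_comp b r.
have [al alE] := projP _ _ r ap r_surj.
have [be beE] := projective_prod projPZ projQ br p_surj.
have im_i x : p x = 0 -> lin_image i x by move=> /ex.
have [de deE] : exists de : {linear P -> C}, forall x, i (de x) = be (al x) - x.
  have [|h hE] := @linear_of R P P (fun x => be (al x) - x).
    by move=> c u v; rewrite !linearP scalerDr addrACA.
  have [|de deE] := factor_injective (f := h) i_inj; last by exists de => x; rewrite deE.
  by move=> x; apply: im_i; rewrite hE linearB beE brE alE apE ba subrr.
have rk x : r x = 0 -> x.2 = 0 /\ lin_image m x.1.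
  by rewrite rE => -[qx x2]; split=> //; apply/mE.
have ral y : r (al (i y)) = 0.
  by rewrite alE apE (_ : p _ = 0) ?linear0 //; apply/ex; exists y.
have [ai aiE] := linear_comp al i; have [ai1 ai1E] := linear_fst ai.
have [|a' a'E] := factor_injective (f := ai1) m_inj.
  by move=> y; rewrite ai1E aiE; have [] := rk _ (ral y).
have [m0 m0E] : exists m0 : {linear Z' -> (PZ * Q)%type}, forall z, m0 z = (m z, 0).
  have [o oE] := linear_zero Z' Q; have [f fE] := linear_pair m o.
  by exists f => y; rewrite fE oE.
have [bm bmE] := linear_comp be m0.
have [|b' b'E] := factor_injective (f := bm) i_inj.
  move=> z; apply: im_i; rewrite bmE beE brE rE m0E /= (_ : q _ = 0).
    by rewrite linear0.
  by apply/mE; exists z.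
have [s sE] := linear_pair a' i.
have [t tE] : exists t : {linear (Z' * P)%type -> C}, forall x, t x = b' x.1 - de x.2.
  by apply: linear_of => c u v; rewrite !linearP /= scalerDr addrACA.
exists s, t => y; apply: i_inj; rewrite tE sE linearB b'E bmE deE m0E a'E ai1E aiE.
have [al2 _] := rk _ (ral y).
by rewrite -al2 -surjective_pairing opprB addrC subrK.
Qed.

Lemma enat_inf_le (P : nat -> Prop) n : P n -> enat_le (enat_inf P) (Fin n).
Proof.
move=> Pn; rewrite /enat_inf; case: pselect => [exP|[]] /=; last first.
  by exists n; apply/asboolP.
by case: ex_minnP => m _; apply; apply/asboolP.
Qed.

Lemma syz_dell j n C : syz j C -> enat_le (dell j C) (Fin n).
Proof.
move=> /syz_retract[N [Z [P [omegaZ projP /retract_summand sumC]]]].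
have : enat_le (dell j C) (Fin 0).
  apply: enat_inf_le; exists C, N, Z; split=> //; last by exists P.
  by have [h hE] := linear_id C; exists h, h => x; rewrite !hE.
by case: dell => //= m /leq_trans; apply.
Qed.

Definition syz_resolution k n X : Prop :=
  exists (C : nat -> fgmod R) (d : forall i, {linear C i.+1 -> C i})
         (e : {linear C 0%N -> X}),
    exact_resolution n d e /\ forall i, (i <= n)%N -> syz (i + k) (C i).

Lemma good_resolution k X : good k X -> exists n, syz_resolution k n X.
Proof.
elim=> {k X} [k X syzX|k X C0 Y i p syzC0 [i_inj ex p_surj] _ [n [C [d [e]]]]].
  have [e eE] := linear_id X.
  pose C i := if i is 0 then X else fgfree R 0.
  have C0 i (x : C i.+1) : x = 0 by exact: fgfree0.
  have dP i : exists d : {linear C i.+1 -> C i}, forall x, d x = 0 by apply: linear_zero.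
  pose d i := sval (cid (dP i)); have dE i x : d i x = 0 := svalP (cid (dP i)) x.
  exists 0%N, C, d, e; split; last by case.
  split=> [x|x|i x|[//|i] _ x]; first by exists x; rewrite eE.
  - by rewrite eE; split=> [->|[y <-]]; [exists 0; rewrite dE | rewrite dE].
  - by rewrite [x]C0 linear0; split=> // _; exists 0; rewrite dE.
  - exact: C0.
move=> [[e_surj ex0 exd Cz] syzC].
have [ie ieE] := linear_comp i e.
pose C' j := if j is j'.+1 then C j' else C0.
pose d' j : {linear C' j.+1 -> C' j} :=
  if j is j'.+1 return {linear C' j.+1 -> C' j} then d j' else ie.
exists n.+1, C', d', p; split; last first.
  by case=> // j ltjn; rewrite addSnnS; apply: syzC.
split=> //; last by case=> // j ltnj; exact: Cz.
- move=> x; split=> [/ex[y <-]|[z <-]].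
    by have [z <-] := e_surj y; exists z; rewrite [LHS]ieE.
  by rewrite /= ieE; apply/ex; exists (e z).
- case=> [x|j]; last exact: exd.
  rewrite /= ieE; split=> [ie0|/ex0->]; last by rewrite linear0.
  by apply/ex0; apply: i_inj; rewrite ie0 linear0.
Qed.

Lemma syz_resolution_isomorphic k n X Y :
  isomorphic X Y -> syz_resolution k n X -> syz_resolution k n Y.
Proof.
move=> [h [g hK gK]] [C [d [e [[e_surj ex0 exd C0] syzC]]]].
have [he heE] := linear_comp h e; exists C, d, he; split=> //; split=> // [y|x].
  by have [x xE] := e_surj (g y); exists x; rewrite heE xE gK.
rewrite heE -ex0; split=> [h0|->]; last by rewrite linear0.
by rewrite -(hK (e x)) h0 -(linear0 h) hK.
Qed.

Lemma ddell_le k n X : syz_resolution k n X -> enat_le (ddell k X) (Fin n).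
Proof.
move=> [C [d [e [res syzC]]]]; apply: enat_inf_le.
exists n; split=> //; exists C, d, e; split=> // i lein.
exact/syz_dell/syzC.
Qed.
End Syzygies.

Section SimpleModules.
Variable R : nzRingType.
Implicit Types S T U V : rmodType R.

Lemma orbit_linear V (v : V) :
  exists f : {linear R^c^o -> V}, forall r, f r = (r : R^c) *: v.
Proof. by apply: linear_of => a u w; rewrite scalerDl scalerA. Qed.

Lemma simple_cyclic S (s : S) : simple S -> s <> 0 ->
  forall v, exists r : R^c, r *: s = v.
Proof.
move=> [_ simS] s0 v; have [f fE] := orbit_linear s.
have [im0|imS] := simS _ (submodule_image f).
  by case: s0; apply: im0; exists 1; rewrite fE scale1r.
by have [r <-] := imS v; exists r; rewrite fE.
Qed.

Lemma simple_isomorphic S T (s : S) (t : T) :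
  simple S -> simple T -> s <> 0 -> t <> 0 ->
  (forall r : R^c, r *: s = 0 <-> r *: t = 0) -> isomorphic S T.
Proof.
move=> simS simT s0 t0 ann.
have [f fE] := orbit_linear s; have [g gE] := orbit_linear t.
have f_surj : surjective f.
  by move=> v; have [r <-] := simple_cyclic simS s0 v; exists r; rewrite fE.
have g_surj : surjective g.
  by move=> v; have [r <-] := simple_cyclic simT t0 v; exists r; rewrite gE.
have [|h hE] := factor_surjective (f := g) f_surj.
  by move=> r; rewrite /kernel fE gE => /ann.
have [|h' h'E] := factor_surjective (f := f) g_surj.
  by move=> r; rewrite /kernel fE gE => /ann.
exists h, h' => v.
  by have [r <-] := f_surj v; rewrite hE h'E.
by have [r <-] := g_surj v; rewrite h'E hE.
Qed.

Lemma simple_submodule (finR : finite_length (R^c^o : rmodType R)) (X : fgmod R) :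
  (exists x : X, x <> 0) ->
  exists (T : fgmod R) (i : {linear T -> X}), injective i /\ simple T.
Proof.
move=> [x x0]; have [n [mu mu_lt _]] := fgmod_finite_length finR X.
pose nonzero (L : X -> Prop) := submodule L /\ exists2 y, L y & y <> 0.
have [|L [sL [y Ly y0]] Lmin] := @exists_min _ nonzero mu.
  by exists (fun=> True); split=> //; exists x.
have [T [i [i_inj iE]]] := sub_fgmod finR sL; exists T, i; split=> //; split.
  by have /iE[t ty] := Ly; exists t => t0; apply: y0; rewrite -ty t0 linear0.
move=> L' sL'; have [[t L't t0]|no] := pselect (exists2 t, L' t & t <> 0); last first.
  by left=> t L't; have [//|t0] := pselect (t = 0); case: no; exists t.
right=> v.
have nzL' : nonzero (fun z => exists2 u, L' u & i u = z).
  split; first exact: submodule_im.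
  by exists (i t); [exists t | move=> it0; apply: t0; apply: i_inj; rewrite it0 linear0].
have L'L z : (exists2 u, L' u & i u = z) -> L z.
  by case=> u _ <-; apply/iE; exists u.
have Liv : L (i v) by apply/iE; exists v.
have [eqL|ltL] := sub_eqVstrict L'L.
  by move: Liv; rewrite -eqL => -[u L'u /i_inj <-].
by have := Lmin _ nzL'; rewrite leqNgt mu_lt //; case: nzL'.
Qed.

End SimpleModules.

Section Algebra.
Variables (K : fieldType) (A : falgType K).

Lemma falg_finite_length : finite_length (A^c^o : rmodType A).
Proof.
pose inside (L : A -> Prop) (U : {vspace A}) := forall u, u \in U -> L u \/ u = 0.
have maxU L : exists U, inside L U /\
    forall U', inside L U' -> (\dim U' <= \dim U)%N.
  have [||U inU Umax] :=
      @exists_max _ (inside L) (fun U : {vspace A} => \dim U) (\dim {:A}).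
  - by exists 0%VS => u; rewrite memv0 => /eqP; right.
  - by move=> U _; rewrite dimvS ?subvf.
  - by exists U.
have [W WP] := choice maxU.
exists (\dim {:A}), (fun L => \dim (W L)); last by move=> L; rewrite dimvS ?subvf.
move=> L L' sL sL' [LL' [v L'v nLv]]; have [inW _] := WP L.
have L0 : L 0 by case: sL.
have inL u : u \in W L -> L u by case/inW=> [//|->].
have vW : v \notin W L by apply/negP => /inL.
have L'Z c : L' (c *: (v : A)).
  by rewrite -mulr_algr; exact: (@submoduleZ _ _ _ (c%:A : A^c) v sL' L'v).
have ltW : (\dim (W L) < \dim (W L + <[v : A]>))%N.
  rewrite ltn_neqAle dimvS ?addvSl // andbT; apply: contra vW => /eqP dimW.
  have /eqP-> : W L == (W L + <[v : A]>)%VS by rewrite eqEdim addvSl dimW leqnn.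
  by apply: subvP (addvSr _ _) _ _; exact: memv_line.
apply: leq_trans ltW _; apply: (WP L').2 => u /memv_addP[w wW [_ /vlineP[c ->] ->]].
left; apply: (@submoduleD _ _ L' w (c *: (v : A)) sL'); last exact: L'Z.
by apply: LL'; apply: inL.
Qed.

End Algebra.

Section OnePoint.
Variables (K : fieldType) (A : falgType K) (M : rmodType A).
Local Notation E := (onept_ext M).
Implicit Types X Y S T : rmodType E.

Definition elt (a : K) (m : M) (x : A) : E := (a, m, x).

Lemma eltM a m x b n y :
  elt a m x * elt b n y = elt (a * b) ((a%:A : A^c) *: n + (y : A^c) *: m) (x * y).
Proof. by []. Qed.

Lemma eltD a m x b n y : elt a m x + elt b n y = elt (a + b) (m + n) (x + y).
Proof. by []. Qed.

Lemma eltE (u : E) : exists a m x, u = elt a m x.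
Proof. by case: u => [[a m] x]; exists a, m, x. Qed.

Definition act X (v : X) (r : E) : X := (r : E^c) *: v.

Lemma actM X (v : X) r s : act (act v r) s = act v (r * s).
Proof. by rewrite /act scalerA. Qed.

Lemma actD X (v : X) r s : act v (r + s) = act v r + act v s.
Proof. exact: scalerDl. Qed.

Lemma act1 X (v : X) : act v 1 = v.
Proof. exact: scale1r. Qed.

Lemma act0 X (v : X) : act v 0 = 0.
Proof. exact: scale0r. Qed.

Lemma act0r X r : act (0 : X) r = 0.
Proof. exact: scaler0. Qed.

Lemma act_linear X Y (f : {linear X -> Y}) v r : f (act v r) = act (f v) r.
Proof. exact: linearZ. Qed.

Lemma onept_finite_length :
  finitely_generated M -> finite_length (E^c^o : rmodType E).
Proof.
move=> fgM.
have finM : finite_length (M * A^c^o)%type.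
  apply: finite_length_prod; last exact: falg_finite_length.
  exact: finitely_generated_finite_length (falg_finite_length A) fgM.
have [n [nu nu_lt nu_le]] := finM.
pose top (L : E -> Prop) := `[< exists2 a, a <> 0 & L (elt a 0 0) >].
pose rad (L : E -> Prop) (z : M * A^c^o) := L (elt 0 z.1 z.2).
have mulL (L : E^c^o -> Prop) u v : submodule L -> L u -> L ((u : E) * (v : E)).
  by move=> sL Lu; apply: (@submoduleZ _ _ _ (v : E^c) u sL Lu).
have topL (L : E^c^o -> Prop) a m x : submodule L -> L (elt a m x) -> L (elt a 0 0).
  move=> sL /(mulL _ _ (elt 1 0 0) sL).
  by rewrite eltM !mulr0 mulr1 scaler0 scale0r addr0.
have radL (L : E^c^o -> Prop) a m x : submodule L -> L (elt a m x) -> L (elt 0 m x).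
  move=> sL /(mulL _ _ (elt 0 0 1) sL).
  by rewrite eltM mulr0 mulr1 scaler0 scale1r add0r.
have sub_rad (L : E^c^o -> Prop) : submodule L -> submodule (rad L).
  move=> sL; split=> [|r [m x] [m' x'] Lz Lz']; first by case: sL.
  have := @submoduleD _ _ L _ _ sL (mulL L _ (elt 0 0 (r : A)) sL Lz) Lz'.
  by rewrite eltM eltD mul0r scaler0 !add0r.
exists n.+1, (fun L : E^c^o -> Prop => top L + nu (rad L))%N; last first.
  by move=> L; rewrite -add1n leq_add // leq_b1.
move=> L L' sL sL' [LL' [v L'v nLv]].
have top_le : (top L <= top L')%N.
  rewrite /top; case: asboolP => // -[a a0 La].
  by case: asboolP => // -[]; exists a => //; apply: LL'.
have rad_le : (nu (rad L) <= nu (rad L'))%N.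
  by apply: length_measure_le; [|exact: sub_rad|exact: sub_rad|move=> z /LL'].
have [a [m [x vE]]] := eltE v; rewrite {}vE in L'v nLv.
have [La|nLa] := pselect (L (elt a 0 0)); last first.
  rewrite -addSn leq_add // /top.
  case: asboolP => [[b b0 Lb]|_].
    case: nLa; have := mulL L _ (elt (b^-1 * a) 0 0) sL Lb.
    by rewrite eltM mulrA divff ?mul1r ?mulr0 ?scaler0 ?addr0 //; apply/eqP.
  case: asboolP => // -[]; exists a; last exact: topL L'v.
  by move=> a0; apply: nLa; rewrite a0; case: sL.
rewrite -addnS leq_add //; apply: nu_lt; try exact: sub_rad.
split=> [z /LL'//|]; exists (m, x); first exact: radL L'v.
move=> Lmx; apply: nLv; have := @submoduleD _ _ L _ _ sL La Lmx.
by rewrite eltD addr0 !add0r.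
Qed.

End OnePoint.

(** * The one-point extension *)

Section DerivedDelooping.
Variables (K : fieldType) (A : falgType K) (M : rmodType A).
Hypotheses (locA : local_ring A) (fgM : finitely_generated M).
Local Notation E := (onept_ext M).
Local Notation e0 := (elt (M := M) 1 0 0).
Local Notation e1 := (elt (M := M) 0 0 1).
Let finE : finite_length (E^c^o : rmodType E) := onept_finite_length fgM.

(* [over_base X] says that the action on [X] factors through [A]. *)
Definition over_base (X : rmodType E) : Prop := forall v : X, act v e0 = 0.

Lemma over_base_inj (X Y : rmodType E) (i : {linear X -> Y}) :
  injective i -> over_base Y -> over_base X.
Proof.
by move=> i_inj baseY v; apply: i_inj; rewrite act_linear baseY linear0.
Qed.

Lemma over_base_surj (X Y : rmodType E) (p : {linear X -> Y}) :
  surjective p -> over_base X -> over_base Y.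
Proof.
by move=> p_surj baseX v; have [u <-] := p_surj v; rewrite -act_linear baseX linear0.
Qed.

Lemma over_base_act (X : rmodType E) (v : X) a m x :
  over_base X -> act v (elt a m x) = act v (elt 0 0 x).
Proof.
move=> baseX; have -> : elt a m x = e0 * elt a m 0 + elt 0 0 x.
  by rewrite eltM eltD !scale1r scale0r mul1r mul0r !addr0 add0r.
by rewrite actD -actM baseX act0r add0r.
Qed.

Fact regular_subproof : finitely_generated (E^c^o : rmodType E).
Proof.
exists 1%N, (fun=> 1) => v; exists (fun=> v).
by rewrite big_ord1 [RHS]mulr1.
Qed.

Definition regular : fgmod E := FGMod regular_subproof.

Lemma projective_regular : projective regular.
Proof.
move=> U W g f g_surj; have [u uE] := g_surj (f 1).
have [h hE] := orbit_linear u; exists h => r.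
by rewrite hE linearZ uE -linearZ; congr (f _); rewrite [LHS]mulr1.
Qed.

Lemma base_projective : exists P : fgmod E,
  [/\ projective P, over_base P & exists x : P, x <> 0].
Proof.
have [f fE] : exists f : {linear E^c^o -> E^c^o}, forall u, f u = e1 * (u : E).
  by apply: linear_of => r u v; rewrite mulrDr mulrA.
have [P [i [i_inj iE]]] := sub_fgmod finE (X := regular) (submodule_image f).
have e1e1 : e1 * e1 = e1 by rewrite eltM mulr0 mulr1 scaler0 scale1r add0r.
have [|r rE] := factor_injective (f := f) i_inj.
  by move=> u; apply/iE; exists u.
have f_i x : f (i x) = i x.
  have [u <-] := (iE (i x)).2 (ex_intro _ x erefl).
  by rewrite !fE mulrA e1e1.
exists P; split.
- apply: projective_retract projective_regular _.
  by exists i, r => x; apply: i_inj; rewrite rE f_i.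
- move=> x; apply: i_inj; rewrite act_linear linear0 -f_i fE.
  have [a [m [y ->]]] := eltE (i x).
  rewrite [LHS](_ : _ = e1 * elt a m y * e0) // !eltM.
  by rewrite !mul0r mulr0 !scaler0 scale0r addr0.
- exists (r e1) => /(congr1 i); rewrite rE fE e1e1 linear0 => -[/eqP].
  by rewrite oner_eq0.
Qed.

Lemma base_annihilator (I : A^c^o -> Prop) :
  maximal_right_ideal I ->
  (forall J : A^c^o -> Prop, maximal_right_ideal J -> forall x, J x <-> I x) ->
  forall (T : rmodType E) (t : T), simple T -> over_base T -> t <> 0 ->
  forall a m x, act t (elt a m x) = 0 <-> I x.
Proof.
move=> maxI uniqI T t simT baseT t0 a m x; rewrite over_base_act //.
pose J (y : A^c^o) := act t (elt 0 0 y) = 0.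
have actDx u y z : act (u : T) (elt 0 0 (y + z)) =
    act u (elt 0 0 y) + act u (elt 0 0 z).
  by rewrite -actD eltD !addr0.
have actMx u y z : act (act (u : T) (elt 0 0 y)) (elt 0 0 z) = act u (elt 0 0 (y * z)).
  by rewrite actM eltM mul0r !scaler0 addr0.
have act1x u : act (u : T) (elt 0 0 1) = u.
  by rewrite -(over_base_act _ 1 0 _ baseT) act1.
apply: (uniqI J _ x); split.
- split=> [|r y z Jy Jz]; first exact: act0.
  rewrite /J -[LHS]/(act t (elt 0 0 ((y : A) * (r : A) + (z : A)))).
  by rewrite actDx -actMx Jy act0r add0r.
- by rewrite /J act1x.
- move=> J' sJ' nJ'1 JJ' y J'y; have [//|ty0] := pselect (J y); case: nJ'1.
  have [r rE] := simple_cyclic simT ty0 t.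
  have [b [n [z rz]]] := eltE r.
  have tyz : act t (elt 0 0 ((y : A) * z)) = t.
    by rewrite -actMx -(over_base_act (act t (elt 0 0 y)) b n z baseT) -rz.
  have J1 : J (1 - (y : A) * z).
    apply: (addIr (act t (elt 0 0 ((y : A) * z)))).
    by rewrite -actDx subrK act1x add0r.
  have J'yz : J' ((y : A) * z) := @submoduleZ _ _ _ (z : A^c) y sJ' J'y.
  have := submoduleD sJ' (JJ' _ J1) J'yz.
  by rewrite -[X in J' X -> _]/((1 - (y : A) * z) + (y : A) * z : A) subrK.
Qed.

Lemma base_simple_isomorphic (S T : rmodType E) :
  simple S -> simple T -> over_base S -> over_base T -> isomorphic S T.
Proof.
move=> simS simT baseS baseT; have [I [maxI uniqI]] := locA.
have [[s s0] _] := simS; have [[t t0] _] := simT.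
apply: (simple_isomorphic simS simT s0 t0) => r; have [a [m [x ->]]] := eltE r.
by rewrite -!/(act _ _) !(base_annihilator maxI uniqI).
Qed.

Lemma base_simple_embedding : exists P : fgmod E,
  [/\ projective P, over_base P &
   forall T : fgmod E, simple T -> over_base T ->
     exists i : {linear T -> P}, injective i].
Proof.
have [P [projP baseP P0]] := base_projective; exists P; split=> // T simT baseT.
have [S [i [i_inj simS]]] := simple_submodule finE P0.
have [h h_bij] := base_simple_isomorphic simT simS baseT (over_base_inj i_inj baseP).
have [f fE] := linear_comp i h; exists f => u v.
by rewrite !fE => /i_inj; apply: bij_inj.
Qed.

Lemma good_over_base k (X : fgmod E) : over_base X -> good k X.
Proof.
have [P [projP baseP embP]] := base_simple_embedding.
elim: k X => [|k IHk] X baseX; first exact: good_syz.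
have good_simple (T : fgmod E) : simple T -> over_base T -> good k.+1 T.
  move=> simT baseT; have [i i_inj] := embP T simT baseT.
  have [Q [p [p_surj pE]]] := quot_fgmod (submodule_image i).
  apply: (good_syzygy finE (IHk Q (over_base_surj p_surj baseP)) projP (i := i) (p := p)).
  by split=> // v; exact: iff_sym (pE v).
have [n lenX] := fgmod_finite_length finE X.
elim: n X baseX lenX => [|n IHn] X baseX lenX;
  (have [X0|] := pselect (forall x : X, x = 0);
    first by apply/good_syz/syz_projective/projective_zero);
  rewrite -existsNP => -[x x0].
  have [mu mu_lt mu_le] := lenX.
  have := mu_lt _ _ (submodule0 X) (submodule_full X).
  rewrite ltnNge (leq_trans (mu_le _)) // => lt_full.
  by suff: false by []; apply: lt_full; split=> //; exists x.
have [T [i [i_inj simT]]] := simple_submodule finE (ex_intro _ x x0).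
have [Q [p [p_surj pE]]] := quot_fgmod (submodule_image i).
have exip : short_exact i p by split=> // v; exact: iff_sym (pE v).
have baseT := over_base_inj i_inj baseX.
apply: (good_ext finE (good_simple T simT baseT) _ exip).
apply: IHn; first exact: over_base_surj p_surj baseX.
apply: length_le_quot p_surj _ lenX; have [[t t0] _] := simT.
exists (i t); first by move=> it0; apply: t0; apply: i_inj; rewrite it0 linear0.
by apply/pE; exists t.
Qed.

Lemma top_annihilator (S : rmodType E) : simple S -> ~ over_base S ->
  exists2 s : S, s <> 0 & forall a m x, act s (elt a m x) = 0 <-> a = 0.
Proof.
move=> simS /existsNP[v]; have : act (act v e0) e0 = act v e0.
  by rewrite actM eltM mulr1 mulr0 scaler0 scale0r addr0.
move: (act v e0) => s se0 s0; exists s => // a m x; split=> [sr0|->].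
  have [//|/eqP a0] := pselect (a = 0); case: s0.
  have := act0r S (elt a^-1 0 0); rewrite -sr0 actM eltM mulfV // mulr0 scaler0.
  by rewrite scale0r addr0 se0.
have [//|w0] := pselect (act s (elt 0 m x) = 0); case: s0.
have [r rE] := simple_cyclic simS w0 s; have [b [n [y ry]]] := eltE r.
have {rE} rE : act (act s (elt 0 m x)) r = s by [].
rewrite -se0 -[in LHS]rE ry !actM !eltM !(mulr0, mul0r, scaler0, scale0r, addr0).
exact: act0.
Qed.

Lemma good_top k (S : fgmod E) : simple S -> ~ over_base S -> good k S.
Proof.
move=> simS nbaseS; have [s s0 ann] := top_annihilator simS nbaseS.
have [f fE] := orbit_linear s.
have f_surj : surjective f.
  by move=> v; have [r <-] := simple_cyclic simS s0 v; exists r; rewrite fE.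
have [Y [j [j_inj jE]]] := kernel_fgmod finE (X := regular) f.
apply: (@good_step _ k S regular Y j f) => //.
  exact: syz_projective projective_regular.
apply: good_over_base => y; apply: j_inj; rewrite act_linear linear0.
have : f (j y) = 0 by apply/jE; exists y.
have [a [m [x jy]]] := eltE (j y); rewrite fE jy => /ann a0.
rewrite [LHS](_ : _ = elt a m x * e0) // eltM a0.
by rewrite mul0r mulr0 scaler0 scale0r addr0.
Qed.

Lemma top_simple_isomorphic (S T : rmodType E) :
  simple S -> simple T -> ~ over_base S -> ~ over_base T -> isomorphic S T.
Proof.
move=> simS simT /(top_annihilator simS)[s s0 annS] /(top_annihilator simT)[t t0 annT].
apply: (simple_isomorphic simS simT s0 t0) => r; have [a [m [x ->]]] := eltE r.
by rewrite -!/(act _ _) annS annT.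
Qed.

Lemma uniform_ddell_bound k (Q : fgmod E -> Prop) :
  (forall X, Q X -> good k X) -> (forall X Y, Q X -> Q Y -> isomorphic X Y) ->
  exists n, forall X, Q X -> enat_le (ddell k X) (Fin n).
Proof.
move=> goodQ isoQ; have [[X QX]|noX] := pselect (exists X, Q X); last first.
  by exists 0%N => X QX; case: noX; exists X.
have [n resX] := good_resolution (goodQ X QX); exists n => Y QY.
apply: (ddell_le finE).
exact: syz_resolution_isomorphic (isoQ X Y QX QY) resX.
Qed.

End DerivedDelooping.

Lemma enat_sup_finite (P : enat -> Prop) n :
  (forall x, P x -> enat_le x (Fin n)) -> enat_sup P <> Infty.
Proof.
move=> Pn; rewrite /enat_sup.
have := @enat_inf_le (fun b => forall x, P x -> enat_le x (Fin b)) n Pn.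
by case: enat_inf.
Qed.

Theorem corollary3p4 (K : fieldType) (A : falgType K) (M : rmodType A) :
  local_ring A -> finitely_generated M ->
  forall k : nat, (1 <= k)%N -> ddell_ring (onept_ext M) k <> Infty.
Proof.
move=> locA fgM k _.
have [||m mP] := @uniform_ddell_bound _ _ _ fgM k
  (fun S => simple S /\ over_base S).
- by move=> S [_]; exact: good_over_base.
- by move=> S T [simS baseS] [simT baseT]; exact: base_simple_isomorphic.
have [||n nP] := @uniform_ddell_bound _ _ _ fgM k
  (fun S => simple S /\ ~ over_base S).
- by move=> S [simS]; exact: good_top.
- by move=> S T [simS baseS] [simT baseT]; exact: top_simple_isomorphic.
have le_trans x a b : (a <= b)%N -> enat_le x (Fin a) -> enat_le x (Fin b).
  by case: x => //= c ab /leq_trans; apply.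
apply: (@enat_sup_finite _ (maxn m n)) => _ [S [simS ->]].
have [baseS|topS] := pselect (over_base S).
  by apply: le_trans (leq_maxl m n) _; apply: mP.
by apply: le_trans (leq_maxr m n) _; apply: nP.
Qed.
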